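(* Let $X=\Gamma\backslash G$ be a complex parallelisable nilmanifold and let $\mathfrak g$ be the complex Lie algebra of $G$. If $\mathfrak g$ is not abelian, then there are small deformations of $X$ (i.e. fibres of the Kuranishi family of $X$ over points arbitrarily close to the base point) which are not complex parallelisable.
   Context: Setting: $G$ is a simply connected complex nilpotent Lie group with Lie algebra $\mathfrak g$, $\Gamma\subset G$ a lattice (discrete cocompact subgroup), and $X=\Gamma\backslash G$ the resulting compact complex manifold, called a complex parallelisable nilmanifold. Write $\mathfrak h$ for the real Lie algebra underlying $\mathfrak g$ and $M$ for the underlying real nilmanifold. The complexification of $\mathfrak h$ is $\mathfrak g_{\mathbb C}=\mathfrak h\otimes_{\mathbb R}\mathbb C=\mathfrak g\oplus\bar{\mathfrak g}$ with $[\bar x,\bar y]=\overline{[x,y]}$ and $[\mathfrak g,\bar{\mathfrak g}]=0$. A left-invariant almost complex structure $J'$ on $M$ corresponds to a decomposition $\mathfrak g_{\mathbb C}=W\oplus\overline W$, $\overline W$ being the space of $(0,1)$-vectors; it is integrable iff $[W,W]\subset W$. The manifold $(M,J')$ is complex parallelisable if $(\mathfrak h,J')$ is a complex Lie algebra (the bracket is $J'$-bilinear), equivalently $J'$ is integrable and $[W,\overline W]=0$. Kuranishi family: let $\bar\partial:\bar{\mathfrak g}^*\to\Lambda^2\bar{\mathfrak g}^*$ be $(\bar\partial\bar\alpha)(\bar x,\bar y)=-\bar\alpha([\bar x,\bar y])$, extended as a derivation to $\Lambda^*\bar{\mathfrak g}^*$ and by $\bar\partial(\bar\alpha\otimes X)=(\bar\partial\bar\alpha)\otimes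 X$ to $\Lambda^*\bar{\mathfrak g}^*\otimes\mathfrak g$. The Schouten bracket is bilinear with $[\bar\alpha\otimes X,\bar\beta\otimes Y]=\bar\alpha\wedge\bar\beta\otimes[X,Y]$ for $\bar\alpha,\bar\beta\in\bar{\mathfrak g}^*$, $X,Y\in\mathfrak g$. Fix a hermitian inner product on $\mathfrak g$, with induced inner products on $\Lambda^k\bar{\mathfrak g}^*$; with $\bar\partial^*$ the adjoint of $\bar\partial$ and $\Delta=\bar\partial\bar\partial^*+\bar\partial^*\bar\partial$ put $\mathcal H^k=\ker(\Delta|_{\Lambda^k\bar{\mathfrak g}^*})$, $B^k=\bar\partial(\Lambda^{k-1}\bar{\mathfrak g}^* )$, $V^k=\bar\partial^*(\Lambda^{k+1}\bar{\mathfrak g}^* )$. One has $\mathcal H^1=\overline{\mathrm{Ann}([\mathfrak g,\mathfrak g])}$ and $H^1(X,\Theta_X)\cong\mathcal H^1\otimes\mathfrak g$. Let $P$, $H$ be the orthogonal projections of $\Lambda^2\bar{\mathfrak g}^*\otimes\mathfrak g$ onto $B^2\otimes\mathfrak g$, $\mathcal H^2\otimes\mathfrak g$, and $\delta$ the inverse of $\bar\partial:V^1\otimes\mathfrak g\to B^2\otimes\mathfrak g$. For $\mu\in\mathcal H^1\otimes\mathfrak g$ set $\Phi_1=\mu$, $\Phi_k=-\delta P\sum_{1\le i<k}[\Phi_i,\Phi_{k-i}]$ ($k\ge2$), $\Phi(\mu)=\sum_{k\ge1}\Phi_k$, and $\mathrm{obs}(\mu)=H[\Phi(\mu),\Phi(\mu)]$.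 The Kuranishi space is $\mathrm{Kur}(X)=\{\mu\in\mathcal H^1\otimes\mathfrak g:\|\mu\|<\epsilon,\ \mathrm{obs}(\mu)=0\}$ for small $\epsilon>0$; the fibre over $\mu$ of the Kuranishi family (the versal family of deformations of $X$) is $M$ with the left-invariant complex structure whose space of $(0,1)$-vectors is $(\mathrm{id}+\Phi(\mu))\bar{\mathfrak g}$, and the base point is $\mu=0$. *)

(* Defs.v *)
From HB Require Import structures.
From mathcomp Require Import all_boot all_order all_algebra.
From mathcomp Require Import generic_quotient complex zify.
From mathcomp Require Import all_classical all_reals all_analysis.

Set Implicit Arguments.
Unset Strict Implicit.
Unset Printing Implicit Defensive.

Import Order.TTheory GRing.Theory Num.Theory.
Import numFieldNormedType.Exports.

Local Open Scope classical_set_scope.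
Local Open Scope ring_scope.

#[short(type="topGroupType")]
HB.structure Definition TopGroup := {G of Topological G & Group G}.

(* The model space is C^(n+1) because the normed module structure on row
   vectors needs a positive dimension. *)
Record chart (C : numClosedFieldType) (n : nat) (T : Type) := Chart {
  chart_dom : set T;
  chart_map : T -> 'rV[C]_n.+1;
  chart_inv : 'rV[C]_n.+1 -> T
}.

Section ComplexLieGroup.
Variables (C : numClosedFieldType) (n : nat).
Local Notation E := 'rV[C]_n.+1.

Definition chart_cod (T : Type) (c : chart C n T) : set E :=
  chart_map c @` chart_dom c.

Record is_chart (T : topologicalType) (c : chart C n T) : Prop := {
  chart_dom_open : open (chart_dom c);
  chart_cod_open : open (chart_cod c);
  chart_mapK : {in chart_dom c, cancel (chart_map c) (chart_inv c)};
  chart_map_continuous : {in chart_dom c, continuous (chart_map c)};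
  chart_inv_continuous : {in chart_cod c, continuous (chart_inv c)}
}.

(* [differentiable] is Frechet differentiability over the scalar field C, so
   for C the complex numbers differentiability on an open set is holomorphy. *)
Record is_holomorphic_atlas (T : topologicalType) (A : set (chart C n T))
  : Prop := {
  atlas_charts : forall c, A c -> is_chart c;
  atlas_cover : forall x, exists2 c, A c & chart_dom c x;
  atlas_transition : forall c d, A c -> A d ->
    forall x, chart_dom c x -> chart_dom d x ->
      differentiable (chart_map d \o chart_inv c) (chart_map c x)
}.

Record is_complex_lie_group (G : topGroupType) (A : set (chart C n G))
  : Prop := {
  lie_group_hausdorff : hausdorff_space G;
  lie_group_second_countable : @second_countable G;
  lie_group_atlas : is_holomorphic_atlas A;
  lie_group_mul_continuous : continuous (fun p : G * G => (p.1 * p.2)%g);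
  lie_group_inv_continuous : continuous (fun x : G => (x^-1)%g);
  lie_group_mul_holomorphic : forall c d f, A c -> A d -> A f ->
    forall x y, chart_dom c x -> chart_dom d y -> chart_dom f (x * y)%g ->
      differentiable
        (fun p : E * E => chart_map f (chart_inv c p.1 * chart_inv d p.2)%g)
        (chart_map c x, chart_map d y);
  lie_group_inv_holomorphic : forall c d, A c -> A d ->
    forall x, chart_dom c x -> chart_dom d (x^-1)%g ->
      differentiable
        (fun u : E => chart_map d (chart_inv c u)^-1%g) (chart_map c x)
}.

(* The left-invariant vector field with value x at the identity, read in a
   chart c around the identity. *)
Definition left_invariant_field (G : topGroupType) (c : chart C n G) (x u : E)
  : E :=
  'D_x (fun v => chart_map c (chart_inv c u * chart_inv c v)%g)
       (chart_map c 1%g).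

Definition vector_field_bracket (X Y : E -> E) (u : E) : E :=
  'D_(X u) Y u - 'D_(Y u) X u.

End ComplexLieGroup.

Definition path_in (R : realType) (T : topologicalType) (p : R -> T) :=
  {within `[0, 1], continuous p}.

Record simply_connected (R : realType) (T : topologicalType) : Prop := {
  simply_connected_path : forall x y : T,
    exists p : R -> T, [/\ path_in p, p 0 = x & p 1 = y];
  simply_connected_loop : forall p : R -> T, path_in p -> p 0 = p 1 ->
    exists H : R * R -> T,
      [/\ {within `[0, 1] `*` `[0, 1], continuous H},
          forall s, s \in `[0, 1] -> H (s, 0) = p s,
          forall s, s \in `[0, 1] -> H (s, 1) = p 0 &
          forall t, t \in `[0, 1] -> H (0, t) = p 0 /\ H (1, t) = p 0]
}.

Record subgroup (G : groupType) := Subgroup {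
  subgroup_set :> set G;
  subgroup1 : subgroup_set 1%g;
  subgroupM : forall x y,
    subgroup_set x -> subgroup_set y -> subgroup_set (x * y)%g;
  subgroupV : forall x, subgroup_set x -> subgroup_set (x^-1)%g
}.

Section Cosets.
Variables (G : topGroupType) (Gam : subgroup G).

(* Gam x = Gam y *)
Definition same_coset : rel G := fun x y => (x * y^-1)%g \in (Gam : set G).

Lemma same_coset_refl : reflexive same_coset.
Proof. by move=> x; rewrite /same_coset mulgV inE; exact: subgroup1. Qed.

Lemma same_coset_sym : symmetric same_coset.
Proof.
suff H x y : same_coset x y -> same_coset y x by move=> x y; apply/idP/idP; apply: H.
by rewrite /same_coset !inE => /subgroupV; rewrite invgM invgK.
Qed.

Lemma same_coset_trans : transitive same_coset.
Proof.
move=> y x z; rewrite /same_coset !inE => xy yz.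
by have := subgroupM xy yz; rewrite mulgA mulgVK.
Qed.

Canonical same_coset_equiv :=
  EquivRel same_coset same_coset_refl same_coset_sym same_coset_trans.

Definition coset_space := quotient_topology {eq_quot same_coset}%qT.

Record is_lattice : Prop := {
  lattice_discrete : forall x, (Gam : set G) x ->
    exists2 U : set G, open U & U `&` (Gam : set G) = [set x];
  lattice_cocompact : compact [set: coset_space]
}.
End Cosets.

Record lie_bracket (C : fieldType) (V : lmodType C) := LieBracket {
  bracket :> {bilinear V -> V -> V};
  bracketxx : forall x, bracket x x = 0;
  bracket_jacobi : forall x y z,
    bracket x (bracket y z) + bracket y (bracket z x)
      + bracket z (bracket x y) = 0
}.

Definition lie_abelian (C : fieldType) (V : lmodType C) (L : lie_bracket V) :=
  forall x y, L x y = 0.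

Fixpoint lower_central (C : fieldType) (g : vectType C) (L : lie_bracket g)
  (k : nat) : {vspace g} :=
  if k is k'.+1 then
    <<[seq L x y | x <- vbasis fullv, y <- vbasis (lower_central L k')]>>%VS
  else fullv.

(* For a connected Lie group this is nilpotency of the group. *)
Definition lie_nilpotent (C : fieldType) (g : vectType C) (L : lie_bracket g) :=
  exists k, lower_central L k = 0%VS.

(* The bracket L on g is that of the Lie algebra of G: a linear isomorphism
   from g to the tangent space at the identity carries L to the bracket of
   left-invariant vector fields. *)
Definition is_lie_algebra_of (C : numClosedFieldType) (n : nat)
  (G : topGroupType) (A : set (chart C n G)) (g : vectType C)
  (L : lie_bracket g) :=
  exists2 c, A c /\ chart_dom c 1%g &
  exists2 theta : {linear g -> 'rV[C]_n.+1}, bijective theta &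
    forall x y, theta (L x y) =
      vector_field_bracket (left_invariant_field c (theta x))
        (left_invariant_field c (theta y)) (chart_map c 1%g).

(* The complex vector space conjugate to V, with xbar represented by x. *)
Definition conj_space (C : numClosedFieldType) (V : lmodType C) : Type := V.

Section ConjSpace.
Variables (C : numClosedFieldType) (V : lmodType C).

HB.instance Definition _ := GRing.Zmodule.on (conj_space V).

Definition conj_scale (a : C) (x : conj_space V) : conj_space V :=
  a^* *: (x : V).

Fact conj_scaleA a b x : conj_scale a (conj_scale b x) = conj_scale (a * b) x.
Proof. by rewrite /conj_scale scalerA rmorphM. Qed.
Fact conj_scale1 : left_id 1 conj_scale.
Proof. by move=> x; rewrite /conj_scale rmorph1 scale1r. Qed.
Fact conj_scaleDr : right_distributive conj_scale +%R.
Proof. by move=> a x y; rewrite /conj_scale scalerDr. Qed.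
Fact conj_scaleDl x : {morph conj_scale^~ x : a b / a + b}.
Proof. by move=> a b; rewrite /conj_scale rmorphD scalerDl. Qed.

HB.instance Definition _ := GRing.Zmodule_isLmodule.Build C (conj_space V)
  conj_scaleA conj_scale1 conj_scaleDr conj_scaleDl.
End ConjSpace.

Section LeftInvariantStructures.
Variables (C : numClosedFieldType) (g : vectType C) (L : lie_bracket g).

(* g_C = g (+) gbar, the pair (x, y) standing for x + ybar *)
Definition gC : lmodType C := (g * conj_space g)%type.

Definition gC_bracket (v w : gC) : gC := (L v.1 w.1, L v.2 w.2).

Definition gC_conj (v : gC) : gC := (v.2, v.1).

(* The real Lie algebra h is g with scalars restricted to the real numbers. It
   embeds in g_C as the fixed points x + xbar of conjugation, and v in g_C is
   h_re v + i h_im v with both parts in h. *)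
Definition h_incl (x : g) : gC := (x, x).

Definition h_re (v : gC) : g := 2^-1 *: (v.1 + (v.2 : g)).
Definition h_im (v : gC) : g := (2 * 'i)^-1 *: (v.1 - (v.2 : g)).

Lemma h_re_im v : v = h_incl (h_re v) + 'i *: h_incl (h_im v).
Proof.
have half (x : g) : 2^-1 *: x + 2^-1 *: x = x.
  by rewrite -mulr2n -scaler_nat scalerA divff ?pnatr_eq0// scale1r.
have iE : 'i * (2 * 'i)^-1 = 2^-1 :> C.
  by rewrite invfM mulrCA divff ?neq0Ci// mulr1.
case: v => a b; congr pair => /=.
  rewrite /h_re /h_im /= scalerA iE -scalerDr addrACA subrr addr0.
  by rewrite scalerDr half.
have -> : 'i *: (h_im (a, b) : conj_space g) = - 2^-1 *: (a - (b : g)) :> g.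
  transitivity ('i^* *: h_im (a, b)); first by [].
  by rewrite /h_im scalerA conjCi mulNr iE.
change (b = 2^-1 *: (a + b) + - 2^-1 *: (a - b) :> g).
rewrite scaleNr -scalerBr opprB.
by rewrite [_ - a]addrC addrACA subrr add0r scalerDr half.
Qed.

(* complex-linear extension of a real-linear endomorphism of h *)
Definition complexify (J : g -> g) (v : gC) : gC :=
  h_incl (J (h_re v)) + 'i *: h_incl (J (h_im v)).

Definition type10 (J : g -> g) : set gC := [set v | complexify J v = 'i *: v].
Definition type01 (J : g -> g) : set gC :=
  [set v | complexify J v = - 'i *: v].

Record is_left_invariant_complex_structure (J : g -> g) : Prop := {
  lics_real_linear : forall a x y, a \is Num.real ->
    J (a *: x + y) = a *: J x + J y;
  lics_sqr : forall x, J (J x) = - x;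
  lics_integrable : forall v w, type10 J v -> type10 J w ->
    type10 J (gC_bracket v w)
}.

(* The bracket of h is J-bilinear, that is, (h, J) is a complex Lie algebra. *)
Definition complex_parallelisable (J : g -> g) :=
  forall x y, L (J x) y = J (L x y) /\ L x (J y) = J (L x y).

End LeftInvariantStructures.

(* Relative to a basis e of g, with conjugate dual basis ebar^i of gbar^*, the
   function w stands for the element sum_S ebar^S (x) w S of
   Lambda^* gbar^* (x) U, where ebar^S = ebar^i1 /\ ... /\ ebar^ik for
   S = {i1 < ... < ik}. *)
Notation ext n U := {ffun {set 'I_n} -> U}.

(* ebar^S /\ ebar^T = wedge_sign S T * ebar^(S :|: T) for disjoint S and T *)
Definition wedge_sign (C : pzRingType) (n : nat) (S T : {set 'I_n}) : C :=
  (-1) ^+ #|[set p in finset.setX S T | (p.2 < p.1)%N]%SET|.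

Definition wedge (C : pzRingType) (n : nat) (a b : ext n C) : ext n C :=
  [ffun T : {set 'I_n} => \sum_(S : {set 'I_n} | S \subset T)
    wedge_sign C S (T :\: S) * a S * b (T :\: S)].

Section Kuranishi.
Variables (C : numClosedFieldType) (n : nat) (g : vectType C).
Variables (L : lie_bracket g) (h : {dot g for (@Num.conj C)}).
Variable e : n.-tuple g.

Local Notation Ext := (ext n g).

(* For e orthonormal this is the inner product induced by h: the ebar^S are
   orthonormal. *)
Definition ext_form (v w : Ext) : C := \sum_(S : {set 'I_n}) h (v S) (w S).

Fact ext_form_bilinear :
  bilinear_for *%R (@Num.conj C \; *%R) ext_form.
Proof.
split=> [w a u v | u a v w]; rewrite /ext_form /=;
  rewrite mulr_sumr -big_split /=; apply: eq_bigr => S _; rewrite !ffunE.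
- by rewrite linearPl.
- by rewrite linearPr.
Qed.
HB.instance Definition _ := bilinear_isBilinear.Build C Ext Ext C
  *%R (@Num.conj C \; *%R) ext_form ext_form_bilinear.

Fact ext_form_hermitian v w :
  ext_form v w = (-1) ^+ false * (ext_form w v)^*.
Proof.
rewrite expr0 mul1r rmorph_sum; apply: eq_bigr => S _.
by rewrite [LHS]hermC expr0 mul1r.
Qed.
HB.instance Definition _ := isHermitianSesquilinear.Build C Ext false
  (@Num.conj C) ext_form ext_form_hermitian.

Fact ext_form_gt0 v : v != 0 -> 0 < ext_form v v.
Proof.
move=> v0; have [S vS0] : exists S, v S != 0.
  apply/existsP; apply: contraNT v0; rewrite negb_exists => /forallP v0.
  by apply/eqP/ffunP => S; rewrite ffunE; apply/eqP; rewrite -[_ == _]negbK.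
rewrite /ext_form (bigD1 S)//= ltr_wpDr ?dnorm_gt0//.
by apply: sumr_ge0 => T _; exact: dnorm_ge0.
Qed.
HB.instance Definition _ := isDotProduct.Build C Ext ext_form ext_form_gt0.

Definition ext_norm (w : Ext) : C := sqrtC (ext_form w w).

Definition ext_monomial (S : {set 'I_n}) : ext n C :=
  [ffun T : {set 'I_n} => (T == S)%:R].

(* dbar (ebar^i) = - sum_(j < k) ebar^i [ebar_j, ebar_k] ebar^j /\ ebar^k *)
Definition dbar_gen (i : 'I_n) : ext n C :=
  [ffun T : {set 'I_n} =>
    - \sum_(p : 'I_n * 'I_n | (p.1 < p.2)%N && (T == [set p.1; p.2]%SET))
        (coord e i (L e`_p.1 e`_p.2))^*].

(* dbar (ebar^S), by the Leibniz rule *)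
Definition dbar_monomial (S : {set 'I_n}) : ext n C :=
  \sum_(i in S) [ffun T : {set 'I_n} => (-1) ^+ #|[set j in S | (j < i)%N]%SET|
    * wedge (dbar_gen i) (ext_monomial (S :\ i)) T].

Lemma dbar_monomial_deg S T : dbar_monomial S T != 0 -> #|T| = #|S|.+1.
Proof.
move=> d0; apply/eqP; move: d0; apply: contraNT => TS.
rewrite /dbar_monomial sum_ffunE big1// => i iS; rewrite ffunE ffunE.
rewrite big1 ?mulr0// => S' S'T; rewrite ffunE [in X in _ * X]ffunE.
have [E|_] := eqVneq (T :\: S') (S :\ i); last by rewrite mulr0.
rewrite big1 ?oppr0 ?mulr0 ?mul0r// => -[j k] /= /andP[jk /eqP S'jk].
have S'2 : #|S'| = 2%N by rewrite S'jk cards2 -val_eqE /= ltn_eqF.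
case/eqP: TS; move: (cardsD1 i S) (cardsID S' T).
by rewrite iS E (finset.setIidPr S'T) S'2 => -> <-.
Qed.

Definition dbar_fun (w : Ext) : Ext :=
  [ffun T : {set 'I_n} => \sum_(S : {set 'I_n}) dbar_monomial S T *: w S].

Definition dbar_adj_fun (w : Ext) : Ext :=
  [ffun S : {set 'I_n} => \sum_(T : {set 'I_n}) (dbar_monomial S T)^* *: w T].

Fact dbar_is_linear : linear dbar_fun.
Proof.
move=> a u v; apply/ffunP => T; rewrite !ffunE scaler_sumr -big_split.
by apply: eq_bigr => S _; rewrite !ffunE scalerDr !scalerA [a * _]mulrC.
Qed.
HB.instance Definition _ :=
  GRing.isLinear.Build C Ext Ext *:%R dbar_fun dbar_is_linear.

Fact dbar_adj_is_linear : linear dbar_adj_fun.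
Proof.
move=> a u v; apply/ffunP => T; rewrite !ffunE scaler_sumr -big_split.
by apply: eq_bigr => S _; rewrite !ffunE scalerDr !scalerA [a * _]mulrC.
Qed.
HB.instance Definition _ :=
  GRing.isLinear.Build C Ext Ext *:%R dbar_adj_fun dbar_adj_is_linear.

Definition dbar : 'End(Ext) := linfun dbar_fun.
Definition dbar_adj : 'End(Ext) := linfun dbar_adj_fun.

Lemma dbar_adjP v w : ext_form (dbar v) w = ext_form v (dbar_adj w).
Proof.
rewrite !lfunE /= /ext_form.
under eq_bigr do rewrite ffunE linear_sumlz.
rewrite exchange_big; apply: eq_bigr => S _.
rewrite ffunE linear_sumr; apply: eq_bigr => T _.
by rewrite linearZl_LR linearZr_LR /= conjCK.
Qed.

Definition laplacian : 'End(Ext) :=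
  (dbar \o dbar_adj + dbar_adj \o dbar)%VF.

Definition off_degree (k : nat) (w : Ext) : Ext :=
  [ffun S : {set 'I_n} => (#|S| != k)%:R *: w S].

Fact off_degree_is_linear k : linear (off_degree k).
Proof.
move=> a u v; apply/ffunP => S.
by rewrite !ffunE scalerDr !scalerA [a * _]mulrC.
Qed.
HB.instance Definition _ k :=
  GRing.isLinear.Build C Ext Ext *:%R (off_degree k) (off_degree_is_linear k).

(* Lambda^k gbar^* (x) g *)
Definition ext_deg (k : nat) : {vspace Ext} := lker (linfun (off_degree k)).

Lemma ext_degP k (w : Ext) :
  reflect (forall S : {set 'I_n}, #|S| != k -> w S = 0) (w \in ext_deg k).
Proof.
rewrite memv_ker lfunE /=; apply: (iffP eqP) => [w0 S Sk|w0].
  by have /ffunP/(_ S) := w0; rewrite !ffunE Sk scale1r.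
apply/ffunP => S; rewrite !ffunE.
by case: eqP => [_|/eqP/w0->]; rewrite ?scale0r ?scaler0.
Qed.

Lemma dbar_deg k (w : Ext) : w \in ext_deg k -> dbar w \in ext_deg k.+1.
Proof.
move=> /ext_degP w0; apply/ext_degP => T Tk; rewrite lfunE ffunE big1// => S _.
have [->|/dbar_monomial_deg ST] := eqVneq (dbar_monomial S T) 0.
  by rewrite scale0r.
by rewrite w0 ?scaler0//; move: Tk; rewrite ST.
Qed.

Lemma dbar_adj_deg k (w : Ext) : w \in ext_deg k.+1 -> dbar_adj w \in ext_deg k.
Proof.
move=> /ext_degP w0; apply/ext_degP => S Sk; rewrite lfunE ffunE big1// => T _.
have [->|/dbar_monomial_deg ST] := eqVneq (dbar_monomial S T) 0.
  by rewrite conjC0 scale0r.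
by rewrite w0 ?scaler0// ST.
Qed.

(* H^k (x) g; B2 and V1 are B^2 (x) g and V^1 (x) g *)
Definition harmonic (k : nat) : {vspace Ext} := (lker laplacian :&: ext_deg k)%VS.
Definition B2 : {vspace Ext} := (dbar @: ext_deg 1)%VS.
Definition V1 : {vspace Ext} := (dbar_adj @: ext_deg 2)%VS.

Definition ortho_proj (U : {vspace Ext}) : 'End(Ext) :=
  daddv_pi U (orthov ext_form U).

Lemma cap_orthov U : (U :&: orthov ext_form U = 0)%VS.
Proof.
apply/eqP; rewrite -subv0; apply/subvP => u; rewrite memv_cap => /andP[uU].
by move=> /mem_orthovP/(_ u uU)/eqP; rewrite dnorm_eq0 memv0.
Qed.

Lemma ortho_projP U v :
  ortho_proj U v \in U /\ v - ortho_proj U v \in orthov ext_form U.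
Proof.
split; first exact: memv_pi.
have vUU : v \in (U + orthov ext_form U)%VS.
  have [x xU [y [-> _ yU]]] := orthogonal_split ext_form (vbasis U) v.
  rewrite memv_add//; first by rewrite -(span_basis (vbasisP U)).
  move: yU; rewrite orthogonalE (span_basis (vbasisP U)) => /subvP; apply.
  by rewrite memv_span// mem_head.
by rewrite -{1}(daddv_pi_add (cap_orthov U) vUU) addrC addKr memv_pi.
Qed.

(* The inverse of dbar : V^1 (x) g -> B^2 (x) g; it takes values in V1 by the
   outer projection. *)
Definition delta : 'End(Ext) :=
  (ortho_proj V1 \o (dbar \o ortho_proj V1)^-1)%VF.

Lemma deltaP b : b \in B2 -> delta b \in V1 /\ dbar (delta b) = b.
Proof.
move=> /memv_imgP[a aD ->]; split; first by rewrite comp_lfunE memv_pi.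
have E : dbar a = dbar (ortho_proj V1 a).
  have [pV oV] := ortho_projP V1 a.
  apply/eqP; rewrite -subr_eq0 -linearB -(dnorm_eq0 ext_form); apply/eqP.
  rewrite [LHS]dbar_adjP; move/mem_orthovP: oV; apply.
  apply/memv_img/dbar_deg; rewrite memvB//.
  have /memv_imgP[v vD ->] := pV; exact: dbar_adj_deg.
rewrite E /delta comp_lfunE -[in LHS](comp_lfunE dbar) -[in LHS](comp_lfunE dbar).
rewrite -(comp_lfunE dbar (ortho_proj V1)) limg_lfunVK//.
by rewrite memv_img// memvf.
Qed.

(* [abar (x) X, bbar (x) Y] = abar /\ bbar (x) [X, Y] *)
Definition schouten (v w : Ext) : Ext :=
  [ffun T : {set 'I_n} => \sum_(S : {set 'I_n} | S \subset T)
    wedge_sign C S (T :\: S) *: L (v S) (w (T :\: S))].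

(* the list Phi_1, ..., Phi_k, so that s`_i is Phi_(i+1) *)
Fixpoint Phi_terms (mu : Ext) (k : nat) : seq Ext :=
  if k is k'.+1 then
    let s := Phi_terms mu k' in
    rcons s (if k' == 0%N then mu else
      - delta (ortho_proj B2 (\sum_(i < k') schouten s`_i s`_(k' - i.+1))))
  else [::].

Definition Phi_term (mu : Ext) (k : nat) : Ext := (Phi_terms mu k)`_k.-1.

Lemma Phi_term1 mu : Phi_term mu 1 = mu.
Proof. by []. Qed.

Lemma Phi_termE mu k : (2 <= k)%N ->
  Phi_term mu k = - delta (ortho_proj B2
    (\sum_(1 <= i < k) schouten (Phi_term mu i) (Phi_term mu (k - i)))).
Proof.
have sz m : size (Phi_terms mu m) = m.
  by elim: m => //= m IH; rewrite size_rcons IH.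
have nthE m i : (i < m)%N -> (Phi_terms mu m)`_i = Phi_term mu i.+1.
  elim: m => // m IH; rewrite ltnS leq_eqVlt => /predU1P[->//|im] /=.
  by rewrite nth_rcons sz im IH.
case: k => [//|[//|k]] _.
have -> : Phi_term mu k.+2 = (rcons (Phi_terms mu k.+1)
    (- delta (ortho_proj B2 (\sum_(i < k.+1)
      schouten (Phi_terms mu k.+1)`_i (Phi_terms mu k.+1)`_(k.+1 - i.+1)))))`_k.+1.
  by [].
rewrite nth_rcons sz ltnn eqxx big_add1 big_mkord.
congr (- delta (ortho_proj B2 _)); apply: eq_bigr => i _.
have ik := ltn_ord i; rewrite !nthE//; last by lia.
by congr (schouten _ (Phi_term _ _)); rewrite (subSn ik).
Qed.

Definition is_Phi (mu Psi : Ext) :=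
  (fun N : nat => ext_norm (Psi - \sum_(1 <= k < N) Phi_term mu k) : C)
    @ \oo --> (0 : C).

Definition Phi (mu : Ext) : Ext := xget 0 [set Psi | is_Phi mu Psi].

Definition obs (mu : Ext) : Ext :=
  ortho_proj (harmonic 2) (schouten (Phi mu) (Phi mu)).

Definition Kur (eps : C) : set Ext :=
  [set mu | [/\ mu \in harmonic 1, ext_norm mu < eps & obs mu = 0]].

(* an element of gbar^* (x) g as a linear map from gbar to g *)
Definition form_map (w : Ext) (y : conj_space g) : g :=
  \sum_(i < n) (coord e i (y : g))^* *: w [set i]%SET.

(* J is the left-invariant complex structure of the fibre over mu *)
Definition is_fibre (mu : Ext) (J : g -> g) :=
  is_left_invariant_complex_structure L J /\
  type01 J = range (fun y : conj_space g => (form_map (Phi mu) y, y) : gC g).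

End Kuranishi.

(* Main.v *)
(* Let X be noncentral and alpha a nonzero linear form vanishing on X and on
   [g,g]; it exists because a nilpotent g with g = [g,g] + CX is abelian. For
   mu = alphabar (x) X one has [mu, mu] = 0, hence Phi(mu) = mu and
   obs(mu) = 0, and all multiples of mu lie in the Kuranishi space. As
   (id + mu) gbar contains ybar + alphabar(ybar) X, the g-component of the
   brackets [W, Wbar] is spanned by the alphabar(ybar) [z, X], which do not all
   vanish. *)
Require Import Defs.
From mathcomp Require Import all_boot all_order all_algebra complex.
From mathcomp Require Import all_classical all_reals all_analysis.
Set Implicit Arguments.
Unset Strict Implicit.
Unset Printing Implicit Defensive.
Import GRing.Theory Num.Theory.
Import numFieldNormedType.Exports.
Local Open Scope classical_set_scope.
Local Open Scope ring_scope.

(** * Nilpotency and the lower central series *)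

Section LowerCentral.
Variables (C : fieldType) (g : vectType C) (L : lie_bracket g).

Lemma lie_bracketC (x y : g) : L x y = - L y x.
Proof.
apply/eqP; rewrite -addr_eq0; apply/eqP.
by have := bracketxx L (x + y);
  rewrite linearDl /= !linearD /= !bracketxx add0r addr0.
Qed.

(** [lower_central] is spanned by brackets of basis vectors only; bilinearity gives all the
    others. *)
Lemma lower_central_bracket k (x y : g) :
  y \in lower_central L k -> L x y \in lower_central L k.+1.
Proof.
move=> yk; rewrite (coord_vbasis (memvf x)) (coord_vbasis yk) linear_sumlz.
apply: memv_suml => i _; rewrite linear_sumr; apply: memv_suml => j _.
rewrite linearZl_LR linearZr_LR /= !memvZ //; apply: memv_span.
by apply: allpairs_f; apply: mem_nth; rewrite size_tuple.
Qed.

Lemma lower_central_le k (U : {vspace g}) :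
  (forall x y, y \in lower_central L k -> L x y \in U) ->
  (lower_central L k.+1 <= U)%VS.
Proof.
move=> kU; apply/span_subvP => _ /allpairsP[[x y] /= [_ yk ->]].
exact/kU/vbasis_mem.
Qed.

(* If g = [g,g] + CX then [g,g] = [g,[g,g]] because [X,X] = 0, so that the
   lower central series is stationary from [g,g] on. *)
Lemma nilpotent_abelian_of_codim1 (X : g) : lie_nilpotent L ->
  (fullv <= lower_central L 1 + <[X]>)%VS -> lie_abelian L.
Proof.
move=> [k Lk0] gX.
have dec (x : g) : exists2 u, u \in lower_central L 1 & exists c, x = u + c *: X.
  have /memv_addP[u uL [_ /vlineP[c ->] ->]] := subvP gX x (memvf x).
  by exists u => //; exists c.
have stat : (lower_central L 1 <= lower_central L 2)%VS.
  apply: lower_central_le => x y _; have [u uL [c ->]] := dec x.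
  have [v vL [d ->]] := dec y.
  rewrite linearDl !linearD /= linearZl_LR !linearZr_LR linearZl_LR /=.
  rewrite bracketxx !scaler0 addr0.
  (* With [X, X] gone, every term has u or v from [g,g] as a factor; [u, X] is turned round to put u
     in the second slot. *)
  by do !apply: memvD; rewrite ?(lie_bracketC u X) ?memvZ ?memvN //;
     apply: (@lower_central_bracket 1).
have allk m : (lower_central L 1 <= lower_central L m.+1)%VS.
  elim: m => [|m IH]; first exact: subvv.
  apply: subv_trans stat _; apply: lower_central_le => x y y1.
  exact/lower_central_bracket/(subvP IH).
move=> x y; apply/eqP; rewrite -memv0 -Lk0.
have xy : L x y \in lower_central L 1 by apply/lower_central_bracket/memvf.
by case: k {Lk0} => [|m]; [exact: memvf | exact: (subvP (allk m))].
Qed.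

End LowerCentral.

(** Take the component orthogonal to [U] of a vector outside it. The antilinear form [h w] will
    serve as alphabar. *)
Lemma exists_orthogonal_outside (C : numClosedFieldType) (g : vectType C)
  (h : {dot g for (@Num.conj C)}) (U : {vspace g}) :
  ~ (fullv <= U)%VS -> exists2 w, w != 0 & {in U, forall u, h w u = 0}.
Proof.
move=> /negP/subvPn[v _ vU].
have [x xU [y [vE _ yU]]] := orthogonal_split h (vbasis U) v.
rewrite (span_basis (vbasisP U)) in xU.
exists y.
  by apply: contraNneq vU => y0; rewrite vE y0 addr0.
apply/mem_orthovP; move: yU; rewrite orthogonalE (span_basis (vbasisP U)).
by move/subvP; apply; rewrite memv_span // mem_head.
Qed.

(** * The norm on forms with values in g *)

Section ExtNorm.
Variables (C : numClosedFieldType) (n : nat) (g : vectType C).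
Variable h : {dot g for (@Num.conj C)}.

Lemma ext_norm_eq0 (w : ext n g) : (ext_norm h w == 0) = (w == 0).
Proof. by rewrite /ext_norm sqrtC_eq0 [LHS]dnorm_eq0. Qed.

Lemma ext_norm_ge0 (w : ext n g) : 0 <= ext_norm h w.
Proof. by rewrite sqrtC_ge0; exact: dnorm_ge0. Qed.

Lemma ext_normZ (a : C) (w : ext n g) : ext_norm h (a *: w) = `|a| * ext_norm h w.
Proof.
rewrite /ext_norm.
have -> : ext_form h (a *: w) (a *: w) = `|a| ^+ 2 * ext_form h w w.
  by rewrite linearZl_LR linearZr_LR /= mulrA normCK.
by rewrite rootCMl ?exprn_ge0 ?normr_ge0 // sqrCK ?normr_ge0.
Qed.

End ExtNorm.

(** * The Kuranishi series when [mu, mu] = 0 *)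

Section SelfCommuting.
Variables (C : numClosedFieldType) (n : nat) (g : vectType C).
Variables (L : lie_bracket g) (h : {dot g for (@Num.conj C)}).
Variable e : n.-tuple g.

Lemma schouten0l (v : ext n g) : schouten L 0 v = 0.
Proof.
apply/ffunP => T; rewrite !ffunE big1 // => S _.
by rewrite ffunE linear0l scaler0.
Qed.

Lemma schouten0r (v : ext n g) : schouten L v 0 = 0.
Proof.
apply/ffunP => T; rewrite !ffunE big1 // => S _.
by rewrite ffunE linear0r scaler0.
Qed.

(** Each bracket in the recursion has a factor of index between 2 and k - 1, zero by induction,
    except [mu, mu] at k = 2. *)
Lemma Phi_term_self_commuting (mu : ext n g) k : schouten L mu mu = 0 ->
  (2 <= k)%N -> Phi_term L h e mu k = 0.
Proof.
move=> mu2; elim/ltn_ind: k => k IH k2; rewrite Phi_termE //.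
rewrite big1_seq ?linear0 ?oppr0 // => i; rewrite mem_index_iota => /andP[_ /andP[i1 ik]].
case: (ltnP 1 i) => [i2|i2]; first by rewrite IH // schouten0l.
have -> : i = 1%N by apply/eqP; rewrite eqn_leq i2.
case: (ltnP 1 (k - 1)) => [k3|k3]; first last.
  have -> : k = 2%N by apply/eqP; rewrite eqn_leq k2 andbT -[2%N]/(1 + 1)%N -leq_subLR.
  exact: mu2.
by rewrite (IH (k - 1)%N) ?schouten0r // subn1 ltn_predL (ltnW k2).
Qed.

Lemma Phi_self_commuting (mu : ext n g) : schouten L mu mu = 0 ->
  Phi L h e mu = mu.
Proof.
move=> mu2.
have sumE N : (2 <= N)%N -> \sum_(1 <= k < N) Phi_term L h e mu k = mu.
  move=> N2; rewrite big_ltn // Phi_term1 big1_seq ?addr0 // => k.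
  by rewrite mem_index_iota => /andP[_ /andP[k2 _]]; exact: Phi_term_self_commuting.
(* Since [Phi] is an [xget] choice, this is used twice: at mu for convergence, at any other limit to
   force its distance from mu to be 0. *)
have cvgE Psi : (fun N : nat => ext_norm h (Psi - \sum_(1 <= k < N) Phi_term L h e mu k) : C)
    @ \oo --> (ext_norm h (Psi - mu) : C).
  apply: cvg_near_cst; near=> N; rewrite sumE //.
  by near: N; exact: nbhs_infty_ge.
apply: xget_unique.
  rewrite /= /is_Phi; have := cvgE mu.
  by have /eqP -> : ext_norm h (mu - mu) == 0 by rewrite ext_norm_eq0 subrr.
move=> Psi /= PsiP; apply/eqP; rewrite -subr_eq0 -(ext_norm_eq0 h); apply/eqP.
exact: (cvg_unique (@norm_hausdorff C C^o) (cvgE Psi) PsiP).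
Unshelve. all: by end_near. Qed.

End SelfCommuting.

(** * Decomposable forms and the complex structures they define *)

Section DecomposableForm.
Variables (C : numClosedFieldType) (n : nat) (g : vectType C).
Variables (L : lie_bracket g) (h : {dot g for (@Num.conj C)}).
Variable e : n.-tuple g.
Hypothesis eb : basis_of fullv e.

(* h(w, .) is antilinear, so it is an element of gbar^*; this is its tensor
   product with X. *)
Definition dot_tensor (w X : g) : ext n g :=
  [ffun S : {set 'I_n} => \sum_(i < n | S == [set i]%SET) h w e`_i *: X].

Lemma dot_tensor1 w X i : dot_tensor w X [set i]%SET = h w e`_i *: X.
Proof.
rewrite ffunE (eq_bigl (pred1 i)) ?big_pred1_eq // => j /=.
by rewrite (inj_eq finset.set1_inj) eq_sym.
Qed.

Lemma dot_tensor_deg w X (S : {set 'I_n}) : #|S| != 1%N -> dot_tensor w X S = 0.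
Proof.
by move=> S1; rewrite ffunE big1 // => i /eqP Si; rewrite Si cards1 in S1.
Qed.

Lemma dot_tensorZ w a X : dot_tensor w (a *: X) = a *: dot_tensor w X.
Proof.
apply/ffunP => S; rewrite !ffunE scaler_sumr; apply: eq_bigr => i _.
by rewrite !scalerA mulrC.
Qed.

Lemma dot_coord w y : \sum_(i < n) (coord e i y)^* * h w e`_i = h w y.
Proof.
rewrite [y in RHS](coord_basis eb (memvf y)) linear_sumr.
by apply: eq_bigr => i _; rewrite linearZr_LR.
Qed.

Lemma form_map_dot_tensor w X (y : conj_space g) :
  form_map e (dot_tensor w X) y = h w (y : g) *: X.
Proof.
rewrite /form_map -dot_coord scaler_suml; apply: eq_bigr => i _.
by rewrite dot_tensor1 scalerA.
Qed.

(** All coefficients are multiples of one X, so only [X, X] occurs. *)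
Lemma schouten_dot_tensor w X :
  schouten L (dot_tensor w X) (dot_tensor w X) = 0.
Proof.
have span S : exists c, dot_tensor w X S = c *: X.
  by exists (\sum_(i < n | S == [set i]%SET) h w e`_i); rewrite ffunE scaler_suml.
apply/ffunP => T; rewrite !ffunE big1 // => S _.
have [c ->] := span S; have [d ->] := span (T :\: S)%SET.
by rewrite linearZl_LR linearZr_LR /= bracketxx !scaler0.
Qed.

Lemma dbar_monomial1 i : dbar_monomial L e [set i]%SET = dbar_gen L e i.
Proof.
rewrite /dbar_monomial finset.big_set1; apply/ffunP => T; rewrite ffunE.
have -> : ([set j in [set i] | (j < i)%N] = finset.set0)%SET.
  by apply/setP => j; rewrite !inE; case: eqP => [->|//]; rewrite ltnn.
(* The second factor is the monomial of the empty set, so only S = T contributes. *)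
rewrite cards0 expr0 mul1r finset.setDv ffunE (bigD1 T) //= big1 => [|S /andP[ST nST]].
  rewrite [in X in _ * X]ffunE !finset.setDv eqxx mulr1 addr0 /wedge_sign.
  by rewrite (_ : finset.finset _ = finset.set0) ?cards0 ?mul1r //;
    apply/setP => p; rewrite !inE andbF.
rewrite [in X in _ * X]ffunE finset.setD_eq0 (_ : (T \subset S) = false) ?mulr0 //.
by apply/negbTE; apply: contraNN nST => TS; rewrite finset.eqEsubset ST.
Qed.

(* In [laplacian] the composition binds looser than the sum, so it denotes
   (dbar dbar^* + dbar^* ) dbar and [harmonic k] is the whole kernel of dbar in
   degree k. In degree 1 this is H^1 (x) g, as dbar^* vanishes there; in degree
   2 it contains H^2 (x) g, so that [obs mu = 0] is at least as strong as the
   vanishing of the obstruction H[Phi, Phi]. *)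
Lemma harmonic_dot_tensor w X : (forall x y, h w (L x y) = 0) ->
  dot_tensor w X \in Defs.harmonic L e 1.
Proof.
move=> wL.
have d0 : dbar L e (dot_tensor w X) = 0.
  apply/ffunP => T; rewrite lfunE /= !ffunE.
  rewrite (bigID (mem [set [set i]%SET | i : 'I_n]%SET)) /= [X in _ + X]big1; last first.
    move=> S nS; rewrite dot_tensor_deg ?scaler0 //.
    by apply: contraNN nS => /cards1P[i ->]; apply: imset_f.
  rewrite big_imset /=; last by move=> i j _ _; exact: finset.set1_inj.
  under eq_bigr do rewrite dbar_monomial1 dot_tensor1 ffunE scalerA mulNr mulr_suml.
  (* For each pair p, summing over i first reassembles h(w, [e_p.1, e_p.2]), which is zero. *)
  rewrite -scaler_suml addr0 sumrN exchange_big big1 ?oppr0 ?scale0r //= => p _.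
  by rewrite (eq_bigl predT) // dot_coord.
rewrite memv_cap; apply/andP; split; last by apply/ext_degP => S; exact: dot_tensor_deg.
by rewrite memv_ker /laplacian comp_lfunE d0 linear0.
Qed.

(* J = i (1 - 2 phi) with phi y = h(w, y) X: when h(w, X) = 0 one has
   phi^2 = 0, and J is the conjugate of i by id + phi. *)
Definition deformed_J (w X y : g) : g := 'i *: y - (2 * 'i * h w y) *: X.

(** Multiplication by i preserves g and gbar, while the antilinear phi exchanges them. *)
Lemma deformed_J_complexify w X (v : gC g) : complexify (deformed_J w X) v =
  ('i *: v.1 - (2 * 'i * h w v.2) *: X,
   'i *: (v.2 : g) - (2 * 'i * h w v.1) *: X) :> gC g.
Proof.
(* Used with c = i on g and c = -i on gbar, where scalars act through their conjugates. *)
have extend c x y : c^* = - c -> deformed_J w X x + c *: deformed_J w X y =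
    'i *: (x + c *: y) - (2 * 'i * h w (x - c *: y)) *: X.
  move=> cC; rewrite /deformed_J linearBr linearZr_LR /= cC mulNr opprK.
  rewrite scalerBr scalerDr !scalerA mulrDr scalerDl opprD (mulrC c 'i) addrACA.
  by rewrite (mulrCA c).
have neg_i x : - 'i *: x = 'i *: (x : conj_space g) :> g.
  by rewrite -conjCi.
set re := h_re v; set im := h_im v.
have v1 : v.1 = re + 'i *: im by have /(congr1 fst) := h_re_im v.
have v2 : v.2 = re - 'i *: im :> g.
  by rewrite -scaleNr neg_i; have /(congr1 snd) := h_re_im v.
congr pair.
  by rewrite v1 v2; apply: extend; exact: conjCi.
have := extend (- 'i) re im; rewrite rmorphN /= conjCi => /(_ erefl).
rewrite !scaleNr opprK v1 v2 => <-; congr (_ + _).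
by rewrite -scaleNr neg_i.
Qed.

Lemma reflected_iE (c : C) (x X : g) :
  'i *: x - (2 * 'i * c) *: X = - ('i *: x) <-> x = c *: X.
Proof.
have n2i : 2 * 'i != 0 :> C by rewrite mulf_neq0 ?neq0Ci ?pnatr_eq0.
have E (z : g) : 'i *: z + 'i *: z = (2 * 'i) *: z by rewrite -scalerDl mulr_natl.
rewrite -scalerA; split=> [/eqP|->].
  by rewrite -addr_eq0 addrAC E subr_eq0 => /eqP /(scalerI n2i).
by apply/eqP; rewrite -addr_eq0 addrAC E subrr.
Qed.

(** The g-component of the eigenvector equation already describes the graph; on it the
    gbar-component holds because h(w, X) = 0. *)
Lemma type01_deformed_J w X : h w X = 0 -> type01 (deformed_J w X) =
  range (fun y : conj_space g => (h w (y : g) *: X, y) : gC g).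
Proof.
move=> wX; apply/seteqP; split=> [[a b]|_ [b _ <-]];
  rewrite /type01 /= deformed_J_complexify /=.
  by move=> [+ _]; rewrite scaleNr => /reflected_iE ->; exists b.
rewrite linearZr_LR /= wX !mulr0 scale0r subr0; congr pair.
  by rewrite [RHS]scaleNr; apply/reflected_iE.
by rewrite -[RHS]/((- 'i)^* *: (b : g)) rmorphN /= conjCi opprK.
Qed.

Lemma type10_deformed_J w X : h w X = 0 -> type10 (deformed_J w X) =
  range (fun x : g => (x, h w x *: X) : gC g).
Proof.
move=> wX; apply/seteqP; split=> [[a b]|_ [a _ <-]];
  rewrite /type10 /= deformed_J_complexify /=.
  move=> [_ E]; exists a => //; congr pair; apply/esym/reflected_iE.
  by rewrite [LHS]E -scaleNr -conjCi.
rewrite linearZr_LR /= wX !mulr0 scale0r subr0; congr pair.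
rewrite -[RHS]/('i^* *: (h w a *: X)) conjCi scaleNr.
by apply/reflected_iE.
Qed.

Lemma deformed_J_structure w X : (forall x y, h w (L x y) = 0) -> h w X = 0 ->
  is_left_invariant_complex_structure L (deformed_J w X).
Proof.
move=> wL wX; split=> [a x y /CrealP ra|x|].
- rewrite /deformed_J linearDr linearZr_LR /= ra scalerDr mulrDr scalerDl opprD.
  rewrite addrACA scalerBr !scalerA (mulrC 'i a) !mulrA.
  by rewrite (mulrC (2 * 'i) a) !mulrA.
- rewrite /deformed_J linearBr !linearZr_LR /= wX mulr0 subr0 conjCi.
  rewrite scalerBr !scalerA -expr2 sqrCi scaleN1r mulNr mulrN scaleNr opprK.
  by rewrite (mulrCA 'i) subrK.
(* A bracket of two vectors of the graph is ([x, y], 0): its second entry is a multiple of [X, X],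
   and h(w, [x, y]) = 0 puts it back on the graph. *)
- rewrite (type10_deformed_J wX) => _ _ [x _ <-] [y _ <-].
  exists (L x y) => //; rewrite /gC_bracket /= wL scale0r.
  by rewrite linearZl_LR linearZr_LR /= bracketxx !scaler0.
Qed.

Lemma deformed_J_not_parallelisable w X y : (forall x y, h w (L x y) = 0) ->
  w != 0 -> L X y != 0 -> ~ complex_parallelisable L (deformed_J w X).
Proof.
(* Bilinearity is tested at w because h(w, w) is nonzero: [J w, y] has the extra term -2i h(w, w)
   [X, y], whereas J [w, y] = i [w, y]. *)
move=> wL w0 Xy /(_ w y)[E _]; move: E; rewrite /deformed_J wL mulr0 scale0r subr0.
rewrite linearBl !linearZl_LR /= => /eqP; rewrite -subr_eq0 addrAC subrr sub0r oppr_eq0.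
by rewrite scaler_eq0 (negbTE Xy) !mulf_eq0 pnatr_eq0 (negbTE (neq0Ci C)) dnorm_eq0 (negbTE w0).
Qed.

End DecomposableForm.

Theorem corollary5p2 (R : realType) (n : nat)
  (G : topGroupType) (A : set (chart R[i] n G)) (Gam : subgroup G)
  (g : vectType R[i]) (L : lie_bracket g)
  (h : {dot g for (@Num.conj R[i])}) (e : n.+1.-tuple g) :
  is_complex_lie_group A -> simply_connected R G ->
  is_lie_algebra_of A L -> lie_nilpotent L -> is_lattice Gam ->
  basis_of fullv e -> orthonormal h e ->
  ~ lie_abelian L ->
  forall eps : R[i], 0 < eps ->
    exists (mu : ext n.+1 g) (J : g -> g),
      [/\ Kur L h e eps mu, is_fibre L h e mu J & ~ complex_parallelisable L J].
Proof.
move=> _ _ _ nilL _ eb _ nab eps eps0.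
have [X [y Xy]] : exists X y, L X y != 0.
  apply: contrapT => none; apply: nab => x y; apply/eqP; apply: contrapT => /negP xy.
  by apply: none; exists x, y.
have proper : ~ (fullv <= lower_central L 1 + <[X]>)%VS.
  by move/(nilpotent_abelian_of_codim1 nilL).
have [w w0 wU] := exists_orthogonal_outside h proper.
have wL x z : h w (L x z) = 0.
  by apply: wU; apply: (subvP (addvSl _ _)); apply: (@lower_central_bracket _ _ _ 0); exact: memvf.
have wX : h w X = 0 by apply: wU; apply: (subvP (addvSr _ _)); exact: memv_line.
pose N := ext_norm h (dot_tensor h e w X).
have N1 : 0 < 1 + N by rewrite ltr_pwDl // ext_norm_ge0.
(* This gives t N < eps, and 1 + N is positive whatever N is. Below, t is absorbed into X, so that
   the lemmas apply to w and t X. *)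
pose t := eps / (1 + N).
have t0 : 0 < t by rewrite divr_gt0.
pose mu := dot_tensor h e w (t *: X).
have PhiE : Phi L h e mu = mu by apply/Phi_self_commuting/schouten_dot_tensor.
have wtX : h w (t *: X) = 0 by rewrite linearZr_LR /= wX mulr0.
exists mu, (deformed_J h w (t *: X)); split.
- split; first exact: harmonic_dot_tensor.
    rewrite /mu dot_tensorZ ext_normZ gtr0_norm // -/N /t mulrAC ltr_pdivrMr //.
    by rewrite ltr_pM2l // ltrDr ltr01.
  by rewrite /obs PhiE schouten_dot_tensor linear0.
- split; first exact: deformed_J_structure.
  rewrite PhiE type01_deformed_J //; congr (image _ _); apply/funext => z.
  by rewrite form_map_dot_tensor.
- apply: (@deformed_J_not_parallelisable _ _ L h w _ y) => //.
  by rewrite linearZl_LR scaler_eq0 negb_or Xy lt0r_neq0.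
Qed.
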